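(* For each $n<\omega$, every topological group in $\mathrm{SSGP}(n)$ is minimally almost periodic; that is, $\mathrm{SSGP}(n)\subseteq\mathrm{m.a.p.}$
   Context: All topological groups are assumed Hausdorff (equivalently, Tychonoff). A topological group $G$ is minimally almost periodic (m.a.p.) if every continuous homomorphism $\phi:G\to K$ with $K$ a compact (Hausdorff) group satisfies $\phi[G]=\{1_K\}$. $1_G$ denotes the identity of $G$, $\mathcal N(1_G)$ the set of neighborhoods of $1_G$ in $G$, and $\langle A\rangle$ the subgroup generated by $A$. The classes $\mathrm{SSGP}(n)$, $0\le n<\omega$, of (Hausdorff) topological groups are defined recursively: (a) $G\in\mathrm{SSGP}(0)$ if $G$ is the trivial group; (b) for $n\ge 0$, $G\in\mathrm{SSGP}(n+1)$ if for every $U\in\mathcal N(1_G)$ there is a family $\mathcal H$ of subgroups of $G$ such that (1) every member of $\mathcal H$ is contained in $U$, (2) $H:=\overline{\langle\bigcup\mathcal H\rangle}$ is normal in $G$, and (3) the quotient topological group $G/H$ is in $\mathrm{SSGP}(n)$. *)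

(* Defs.v *)
From HB Require Import structures.
From mathcomp Require Import all_boot generic_quotient.
From mathcomp Require Import boolp classical_sets functions topology.

Set Implicit Arguments.
Unset Strict Implicit.
Unset Printing Implicit Defensive.

Local Open Scope classical_set_scope.
Local Open Scope quotient_scope.
Local Open Scope group_scope.

HB.structure Definition PreTopologicalGroup := {G of Topological G & Group G}.

HB.mixin Record PreTopologicalGroup_isTopologicalGroup G
    of PreTopologicalGroup G := {
  mulg_continuous : continuous (fun x : G * G => x.1 * x.2) ;
  invg_continuous : continuous (fun x : G => x^-1) ;
}.

HB.structure Definition TopologicalGroup :=
  {G of PreTopologicalGroup G & PreTopologicalGroup_isTopologicalGroup G}.

HB.mixin Record TopologicalGroup_isHausdorff G of TopologicalGroup G := {
  topgroup_hausdorff : hausdorff_space G ;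
}.

(* All topological groups are Hausdorff. *)
#[short(type="topGroupType")]
HB.structure Definition HausdorffTopologicalGroup :=
  {G of TopologicalGroup G & TopologicalGroup_isHausdorff G}.

Section Subgroups.
Context {G : groupType}.

Definition is_subgroup (A : set G) : Prop :=
  [/\ A 1, forall x y, A x -> A y -> A (x * y) & forall x, A x -> A x^-1].

Definition is_normal (A : set G) : Prop := forall x g, A x -> A (x ^ g).

Definition generated (A : set G) : set G := smallest is_subgroup A.

End Subgroups.

Record closedNormalSubgroup (G : topGroupType) := ClosedNormalSubgroup {
  cns_set :> set G ;
  cns_subgroup : is_subgroup cns_set ;
  cns_normal : is_normal cns_set ;
  cns_closed : closed cns_set }.

Section QuotientGroup.
Variables (G : topGroupType) (N : closedNormalSubgroup G).

Definition coset_rel (x y : G) : bool := `[< cns_set N (x^-1 * y) >].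

Lemma coset_relP x y : reflect (cns_set N (x^-1 * y)) (coset_rel x y).
Proof. exact: asboolP. Qed.

Lemma coset_rel_refl : reflexive coset_rel.
Proof.
by move=> x; apply/coset_relP; rewrite mulVg; case: (cns_subgroup N).
Qed.

Lemma coset_rel_sym : symmetric coset_rel.
Proof.
have [_ _ NV] := cns_subgroup N.
by move=> x y; apply/coset_relP/coset_relP => /NV; rewrite invgM invgK.
Qed.

Lemma coset_rel_trans : transitive coset_rel.
Proof.
have [_ NM _] := cns_subgroup N.
move=> y x z /coset_relP xy /coset_relP yz; apply/coset_relP.
by have := NM _ _ xy yz; rewrite mulgA mulgK.
Qed.

Canonical coset_equiv :=
  EquivRel coset_rel coset_rel_refl coset_rel_sym coset_rel_trans.

Definition quotient_group : Type := quotient_topology {eq_quot coset_rel}.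
Local Notation Q := quotient_group.

HB.instance Definition _ := Topological.on Q.

Definition qpi (x : G) : Q := \pi_({eq_quot coset_rel})%qT x.
Definition qrepr (a : Q) : G := repr (a : {eq_quot coset_rel}).

Lemma qreprK : cancel qrepr qpi.
Proof. by move=> a; exact: reprK. Qed.

Lemma qpiP x y : qpi x = qpi y <-> cns_set N (x^-1 * y).
Proof.
split=> [/(@eqmodP _ coset_equiv)/coset_relP //|xy].
exact/(@eqmodP _ coset_equiv)/coset_relP.
Qed.

Definition qone : Q := qpi 1.
Definition qmul (a b : Q) : Q := qpi (qrepr a * qrepr b).
Definition qinv (a : Q) : Q := qpi (qrepr a)^-1.

Lemma qrepr_pi x : cns_set N (x^-1 * qrepr (qpi x)).
Proof. by apply/qpiP; rewrite qreprK. Qed.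

Lemma qmul_pi x y : qmul (qpi x) (qpi y) = qpi (x * y).
Proof.
apply/esym/qpiP; have [_ NM _] := cns_subgroup N.
have := NM _ _ (cns_normal y (qrepr_pi x)) (qrepr_pi y).
by rewrite /conjg invgM !mulgA mulgK.
Qed.

Lemma qinv_pi x : qinv (qpi x) = qpi x^-1.
Proof.
apply/esym/qpiP; have [_ _ NV] := cns_subgroup N.
have := NV _ (cns_normal x^-1 (qrepr_pi x)).
by rewrite /conjg !invgM !invgK mulgA mulgK.
Qed.

Lemma qmulA : associative qmul.
Proof.
move=> a b c; rewrite -[a]qreprK -[b]qreprK -[c]qreprK.
by rewrite !qmul_pi mulgA.
Qed.

Lemma qmul1 : left_id qone qmul.
Proof. by move=> a; rewrite -[a]qreprK qmul_pi mul1g. Qed.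

Lemma qmulr1 : right_id qone qmul.
Proof. by move=> a; rewrite -[a]qreprK qmul_pi mulg1. Qed.

Lemma qmulV : left_inverse qone qinv qmul.
Proof. by move=> a; rewrite -[a]qreprK qinv_pi qmul_pi mulVg. Qed.

Lemma qmulrV : right_inverse qone qinv qmul.
Proof. by move=> a; rewrite -[a]qreprK qinv_pi qmul_pi mulgV. Qed.

HB.instance Definition _ :=
  isGroup.Build Q qmulA qmul1 qmulr1 qmulV qmulrV.

Lemma qpiM : {morph qpi : x y / x * y}.
Proof. by move=> x y; exact/esym/qmul_pi. Qed.

Lemma qpiV : {morph qpi : x / x^-1}.
Proof. by move=> x; exact/esym/qinv_pi. Qed.

Lemma qpi_continuous : continuous qpi.
Proof. exact: (@pi_continuous G {eq_quot coset_rel}). Qed.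

Lemma qopenE (A : set Q) : open A = open (qpi @^-1` A).
Proof. by []. Qed.

Lemma qpi_open (A : set G) : open A -> open (qpi @` A).
Proof.
move=> oA; rewrite qopenE.
have -> : qpi @^-1` (qpi @` A) =
    \bigcup_(n in cns_set N) ((fun x : G => x * n^-1) @^-1` A).
  apply/seteqP; split => x /=.
    move=> [y Ay /qpiP yx]; exists (y^-1 * x) => //=.
    by rewrite invgM invgK mulgA mulgV mul1g.
  move=> [n Nn /= Axn]; exists (x * n^-1) => //; apply/qpiP.
  by rewrite invgM invgK mulgVK.
apply: bigcup_open => n _; apply: open_comp => // x _.
apply: (@continuous_comp _ _ _ (fun x : G => (x, n^-1))
  (fun x : G * G => x.1 * x.2)); last exact: mulg_continuous.
by apply: cvg_pair; [exact: cvg_id|exact: cvg_cst].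
Qed.

Lemma qpi_nbhs x (A : set G) : nbhs x A -> nbhs (qpi x) (qpi @` A).
Proof.
rewrite nbhsE => -[B [oB Bx] BA]; rewrite nbhsE.
exists (qpi @` B); last exact: image_subset.
by split; [exact: qpi_open|exists x].
Qed.

Lemma qmul_continuous : continuous (fun a : Q * Q => a.1 * a.2).
Proof.
move=> [a b] W /= Wab.
have : nbhs (qrepr a, qrepr b)
    ((fun x : G * G => x.1 * x.2) @^-1` (qpi @^-1` W)).
  apply: mulg_continuous => /=; apply: qpi_continuous.
  by rewrite qpiM !qreprK.
case=> -[A B] /= [nA nB] AB.
exists (qpi @` A, qpi @` B) => /=.
  by split; [rewrite -(qreprK a)|rewrite -(qreprK b)]; exact: qpi_nbhs.
move=> [c d] /= [[x Ax <-] [y By <-]].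
by rewrite -qpiM; exact: (AB (x, y)).
Qed.

Lemma qinv_continuous : continuous (fun a : Q => a^-1).
Proof.
move=> a W /= Wa.
have : nbhs (qrepr a) ((fun x : G => x^-1) @^-1` (qpi @^-1` W)).
  apply: invg_continuous => /=; apply: qpi_continuous.
  exact: Wa.
move=> /qpi_nbhs; rewrite qreprK; apply: filterS => c /= [x Wx <-].
by rewrite -qpiV.
Qed.

HB.instance Definition _ := PreTopologicalGroup_isTopologicalGroup.Build Q
  qmul_continuous qinv_continuous.

Lemma quotient_group_hausdorff : hausdorff_space Q.
Proof.
move=> a b; rewrite -[a]qreprK -[b]qreprK => ab; apply/qpiP.
apply: contrapT => Nab.
have : nbhs (qrepr a, qrepr b)
    ((fun x : G * G => x.1^-1 * x.2) @^-1` (~` cns_set N)).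
  apply: (@continuous_comp _ _ _ (fun x : G * G => (x.1^-1, x.2))
    (fun x : G * G => x.1 * x.2)); last first.
  - apply: open_nbhs_nbhs; split => //.
    by apply: closed_openC; exact: cns_closed.
  - exact: mulg_continuous.
  - apply: cvg_pair; last exact: cvg_snd.
    by apply: continuous_comp; [exact: cvg_fst|exact: invg_continuous].
case=> -[A B] /= [nA nB] AB.
have [c [[x Ax <-] [y By /qpiP yx]]] := ab _ _ (qpi_nbhs nA) (qpi_nbhs nB).
apply: (AB (x, y)) => //=; apply/qpiP/esym.
exact/qpiP.
Qed.

HB.instance Definition _ :=
  TopologicalGroup_isHausdorff.Build Q quotient_group_hausdorff.

End QuotientGroup.

Fixpoint SSGP (n : nat) (G : topGroupType) : Prop :=
  match n with
  | 0 => [set: G] = [set 1]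
  | m.+1 => forall U : set G, nbhs 1 U ->
      exists HH : set (set G),
        (forall K, HH K -> is_subgroup K /\ K `<=` U) /\
        (* As the closure of a subgroup, the set below is automatically a
           closed subgroup: the existence of N only asserts normality. *)
        exists N : closedNormalSubgroup G,
          cns_set N = closure (generated (\bigcup_(K in HH) K)) /\
          SSGP m (quotient_group N)
  end.

Definition minimally_almost_periodic (G : topGroupType) : Prop :=
  forall (K : topGroupType) (phi : {multiplicative G -> K}),
    compact [set: K] -> continuous phi -> phi @` [set: G] = [set 1].

(* Main.v *)
(** By induction on n, a group in SSGP(n) acts trivially on every translation
    invariant, equicontinuous space E of bounded functions: subgroups close
    enough to the identity act trivially (a group of operators has no small
    subgroups), so the closed normal subgroup they generate does too, and the
    action descends to the quotient. It remains to separate a point a <> 1 of a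
    compact group K from 1 by such a space. With the Haar mean M on C(K) and a
    symmetric continuous u with u(1) = 1 and u(a) = 0, the convolution operator
    T f (x) = M_y (u (x^-1 y) f(y)) is symmetric, compact, commutes with left
    translations and does not vanish on the orthogonal complement V of the
    functions fixed by a. Maximizing |T f| on the unit ball of V gives an
    eigenfunction of T^2 in V, which a does not fix, and E is its eigenspace. *)

Require Import Defs.
From mathcomp Require Import all_boot all_order all_algebra.
From mathcomp Require Import boolp classical_sets functions reals topology.
From mathcomp Require Import normedtype sequences Rstruct.
From mathcomp Require Import ring lra.

Set Implicit Arguments.
Unset Strict Implicit.
Unset Printing Implicit Defensive.

Import Order.TTheory GRing.Theory Num.Theory.
Import numFieldNormedType.Exports.

Local Open Scope classical_set_scope.
Local Open Scope ring_scope.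

(** * Continuity and uniform continuity on compact groups *)

Section ContinuousGroupOperations.
Context {T : topologicalType} {K : topGroupType}.
Implicit Types a b : T -> K.

Lemma continuous_mulg a b :
  continuous a -> continuous b -> continuous (fun t => a t * b t)%g.
Proof.
move=> ca cb t.
apply: (@continuous_comp _ _ _ (fun t => (a t, b t))
  (fun x : K * K => (x.1 * x.2)%g)); last exact: mulg_continuous.
by apply: cvg_pair; [exact: ca|exact: cb].
Qed.

Lemma continuous_invg a : continuous a -> continuous (fun t => (a t)^-1)%g.
Proof.
move=> ca t; apply: (@continuous_comp _ _ _ a (fun x : K => x^-1)%g).
  exact: ca.
exact: invg_continuous.
Qed.

End ContinuousGroupOperations.

Lemma continuous_translate (K : topGroupType) (T : topologicalType)
    (f : K -> T) (h : K) : continuous f -> continuous (fun x => f (h * x)%g).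
Proof.
move=> cf x; apply: (@continuous_comp _ _ _ (fun x => h * x)%g f).
  apply: (continuous_mulg (a := fun=> h) (b := id)).
    by move=> ?; exact: cvg_cst.
  by move=> ?; exact: cvg_id.
exact: cf.
Qed.

(** A tube-lemma argument: joint continuity at [(x, 1)] gives a product neighborhood on which [h]
    stays within [e / 2] of [h x 1], and compactness of [X] makes one neighborhood of [1] serve all
    [x]. *)
Lemma compact_near_uniform (R : realType) (X : topologicalType)
    (K : topGroupType) (h : X -> K -> R) :
  compact [set: X] -> continuous (fun p : X * K => h p.1 p.2) ->
  forall e, 0 < e -> \forall v \near (1%g : K),
    forall x, `|h x v - h x 1%g| <= e.
Proof.
move=> cX ch e e0.
have : \forall v \near nbhs (1%g : K), [set: X] `<=`
    (fun x => `|h x v - h x 1%g| <= e).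
  move/compact_near_coveringP : cX; apply => x _.
  have e20 : 0 < e / 2 by rewrite divr_gt0.
  have /cvgrPdist_le/(_ _ e20) := ch (x, 1%g).
  case=> -[A B] /= [nA nB] AB.
  exists (A, B) => //= -[x' v] /= [Ax' Bv].
  have /= h1 := AB (x', v) (conj Ax' Bv).
  have /= h2 := AB (x', 1%g) (conj Ax' (nbhs_singleton nB)).
  move: h1 h2; rewrite !ler_norml; lra.
by apply: filterS => v H x; exact: H.
Qed.

(** * The Haar mean of a compact group, by averaging over finitely many translates *)

Section HaarMean.
Context {R : realType} {K : topGroupType}.
Hypothesis cK : compact [set: K].
Implicit Types (f : K -> R) (s t : seq K) (e : R).

Lemma finite_net (U : set K) : nbhs (1%g : K) U ->
  exists s : seq K, forall x, exists2 g, g \in s & U (g * x)%g.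
Proof.
move=> nU.
(* Lists directed by inclusion form a filter, so the covering form of compactness merges the local
   choices [x^-1] into one finite list. *)
pose F : set_system (seq K) := [set S | exists s0 : seq K,
  forall s, {subset s0 <= s} -> S s].
have FF : Filter F.
  apply: Build_Filter.
  - by exists [::].
  - move=> P Q [s0 Ps0] [s1 Qs1]; exists (s0 ++ s1) => s ss; split.
      by apply: Ps0 => x xs; apply: ss; rewrite mem_cat xs.
    by apply: Qs1 => x xs; apply: ss; rewrite mem_cat xs orbT.
  - by move=> P Q PQ [s0 Ps0]; exists s0 => s /Ps0/PQ.
have : \forall s \near F, [set: K] `<=`
    (fun x => exists2 g, g \in s & U (g * x)%g).
  move/compact_near_coveringP : cK; apply => x _.
  have : nbhs x ((fun y => x^-1 * y)%g @^-1` U).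
    apply: (continuous_mulg (T := K)) => /=.
    - by move=> ?; exact: cvg_cst.
    - by move=> ?; exact: cvg_id.
    - by rewrite mulVg.
  move=> nx; exists ((fun y => x^-1 * y)%g @^-1` U,
      [set s : seq K | x^-1%g \in s]) => /=.
    split => //; exists [:: x^-1%g] => s; apply; exact: mem_head.
  by move=> [y s] /= [Uy xs]; exists x^-1%g.
case=> s0 /(_ s0 (fun _ => id)) H; exists s0 => x; exact: H.
Qed.

(** Lists count multiplicities, so an average of an average is again an average, over the list of
    products ([avg_avg]). The empty list gives [0], whence the assumptions [s != [::]] below. *)
Definition avg s f : K -> R :=
  fun x => (\sum_(g <- s) f (g * x)%g) / (size s)%:R.

Definition ravg s f : K -> R :=
  fun x => (\sum_(g <- s) f (x * g)%g) / (size s)%:R.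

Lemma size_gt0R s : s != [::] -> 0 < (size s)%:R :> R.
Proof. by move=> s0; rewrite ltr0n lt0n size_eq0. Qed.

Lemma ler_sum_mulr_size (F : K -> R) s c :
  (forall g, c <= F g) -> c * (size s)%:R <= \sum_(g <- s) F g.
Proof.
move=> cF; elim: s => [|g s IH]; first by rewrite big_nil mulr0.
by rewrite big_cons /= -natr1 mulrDr mulr1 addrC lerD.
Qed.

Lemma avg_ge s f c : s != [::] -> (forall x, c <= f x) ->
  forall x, c <= avg s f x.
Proof.
move=> s0 cf x; rewrite ler_pdivlMr ?size_gt0R //.
exact: ler_sum_mulr_size.
Qed.

Lemma avgN s f x : avg s (fun y => - f y) x = - avg s f x.
Proof. by rewrite /avg sumrN mulNr. Qed.

Lemma avgD s f g x : avg s (fun y => f y + g y) x = avg s f x + avg s g x.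
Proof. by rewrite /avg big_split mulrDl. Qed.

Lemma avgZ s c f x : avg s (fun y => c * f y) x = c * avg s f x.
Proof. by rewrite /avg -mulr_sumr mulrA. Qed.

Lemma avg_le s f c : s != [::] -> (forall x, f x <= c) ->
  forall x, avg s f x <= c.
Proof.
move=> s0 fc x; rewrite -lerN2 -avgN; apply: avg_ge => // y.
by rewrite lerN2.
Qed.

Lemma avg_cst s c x : s != [::] -> avg s (fun=> c) x = c.
Proof.
by move=> s0; apply/eqP; rewrite eq_le avg_le ?avg_ge // => y; rewrite lexx.
Qed.

(** Inversion exchanges left and right averages, so facts about [ravg] are read off from [avg]. *)
Lemma ravgE s f x : ravg s f x =
  avg [seq g^-1 | g <- s]%g (fun y => f y^-1%g) x^-1%g.
Proof.
rewrite /ravg /avg size_map big_map; congr (_ / _).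
by apply: eq_bigr => g _; rewrite invgM !invgK.
Qed.

Lemma avg_dist s f c e : s != [::] -> (forall x, `|f x - c| <= e) ->
  forall x, `|avg s f x - c| <= e.
Proof.
move=> s0 fc x; rewrite ler_distl avg_ge ?avg_le // => y;
  by have := fc y; rewrite ler_distl => /andP[].
Qed.

Lemma avg_avg s t f x :
  avg t (avg s f) x = avg [seq (g * h)%g | h <- t, g <- s] f x.
Proof.
rewrite /avg size_allpairs big_allpairs_dep natrM invfM mulrA -mulr_suml.
rewrite mulrAC; congr (_ / _ / _).
by apply: eq_bigr => h _; apply: eq_bigr => g _; rewrite mulgA.
Qed.

Lemma allpairs_neq0 s t : s != [::] -> t != [::] ->
  [seq (g * h)%g | h <- t, g <- s] != [::].
Proof. by rewrite -!size_eq0 size_allpairs muln_eq0 negb_or => -> ->. Qed.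

Lemma avg_ravg s t f x : avg s (ravg t f) x = ravg t (avg s f) x.
Proof.
rewrite /avg /ravg -!mulr_suml mulrAC; congr (_ / _ / _).
rewrite exchange_big; apply: eq_bigr => h _; apply: eq_bigr => g _.
by rewrite mulgA.
Qed.

Lemma continuous_near_mulgr f : continuous f -> forall e, 0 < e ->
  \forall v \near (1%g : K), forall x, `|f (x * v)%g - f x| <= e.
Proof.
move=> cf e e0.
have := @compact_near_uniform R K K (fun x v => f (x * v)%g) cK.
move=> /(_ _ e e0) H; have : continuous (fun p : K * K => f (p.1 * p.2)%g).
  move=> p; apply: (@continuous_comp _ _ _ (fun p => p.1 * p.2)%g f).
    exact: mulg_continuous.
  exact: cf.
move=> /H; apply: filterS => v Hv x; by have := Hv x; rewrite mulg1.
Qed.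

(** Left translations commute with the right perturbation by [v], so averaging preserves the modulus
    of continuity. *)
Lemma avg_equicontinuous s f (U : set K) e : s != [::] ->
  (forall v, U v -> forall x, `|f (x * v)%g - f x| <= e) ->
  forall v, U v -> forall x, `|avg s f (x * v)%g - avg s f x| <= e.
Proof.
move=> s0 Hf v Uv x.
have -> : avg s f (x * v)%g - avg s f x =
    avg s (fun y => f (y * v)%g - f y) x.
  rewrite /avg -mulrBl -sumrB; congr (_ / _).
  by apply: eq_bigr => g _; rewrite mulgA.
rewrite -[X in `|X|]subr0; apply: avg_dist => // y.
by rewrite subr0; exact: Hf.
Qed.

Lemma sum_ge_gap (F : K -> R) s c d g0 : g0 \in s ->
  (forall g, c <= F g) -> c + d <= F g0 ->
  c * (size s)%:R + d <= \sum_(g <- s) F g.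
Proof.
move=> g0s cF cd; rewrite (big_rem g0) //=.
have := ler_sum_mulr_size (rem g0 s) cF.
rewrite (perm_size (perm_to_rem g0s)) /= -natr1; lra.
Qed.

(** For every [x] at least one translate [g * x] lands in [U]; this single term lifts the average by
    [d] divided by the number of terms. *)
Lemma avg_ge_gap s f (U : set K) c d : 
  (forall x, exists2 g, g \in s & U (g * x)%g) ->
  (forall x, c <= f x) -> (forall x, U x -> c + d <= f x) ->
  forall x, c + d / (size s)%:R <= avg s f x.
Proof.
move=> net cf cdf x; have [g gs Ug] := net x.
have s0 : s != [::] by case: (s) gs.
rewrite ler_pdivlMr ?size_gt0R // mulrDl divfK ?gt_eqF ?size_gt0R //.
by apply: (sum_ge_gap gs) => //; exact: cdf.
Qed.

Lemma avg_le_gap s f (U : set K) c d : 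
  (forall x, exists2 g, g \in s & U (g * x)%g) ->
  (forall x, f x <= c) -> (forall x, U x -> f x <= c - d) ->
  forall x, avg s f x <= c - d / (size s)%:R.
Proof.
move=> net cf cdf x; rewrite -lerN2 opprB addrC -avgN.
apply: (avg_ge_gap net) => y; first by rewrite lerN2.
by move=> /cdf; lra.
Qed.

Lemma continuous_bounded f : continuous f -> exists B, forall x, `|f x| <= B.
Proof.
move=> cf; have := continuous_near_mulgr cf ltr01.
move=> /finite_net[s net]; exists (\sum_(g <- s) `|f g^-1%g| + 1) => x.
have [g gs /(_ g^-1)%g] := net x; rewrite mulKg => H.
have : `|f g^-1%g| <= \sum_(g <- s) `|f g^-1%g|.
  by rewrite (big_rem g) //= lerDl sumr_ge0.
have := ler_normB (f x - f g^-1%g) (- f g^-1%g).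
rewrite opprK subrK normrN; lra.
Qed.

(* All averages of f share its modulus of right uniform continuity, so the size
   of the net r, and hence the gain d0 of each further averaging, is uniform. *)
Lemma avg_shrink f : continuous f -> forall e, 0 < e ->
  exists s, s != [::] /\ exists m, forall x, m <= avg s f x <= m + e.
Proof.
move=> cf e e0.
have e40 : 0 < e / 4 by rewrite divr_gt0.
pose U : set K := [set v | forall x, `|f (x * v)%g - f x| <= e / 4].
have nU : nbhs (1%g : K) U := continuous_near_mulgr cf e40.
have [r net] := finite_net nU.
have r0 : r != [::] by have [g] := net 1%g; case: (r).
pose d0 := e / 4 / (size r)%:R.
have d00 : 0 < d0 by rewrite divr_gt0 ?size_gt0R.
have [B fB] := continuous_bounded cf.
pose D d := exists s, s != [::] /\ exists m, forall x, m <= avg s f x <= m + d.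
have step d : e <= d -> D d -> D (d - d0).
  move=> ed [s [s0 [m Hm]]].
  exists [seq (g * h)%g | h <- r, g <- s]; split; first exact: allpairs_neq0.
  have eqc := @avg_equicontinuous s f U (e / 4) s0 (fun _ => id).
  have {}eqc v : U v -> `|avg s f v - avg s f 1%g| <= e / 4.
    by move=> /eqc /(_ 1%g); rewrite mul1g.
  (* If the value at [1] lies in the lower half of [[m, m + d]], the average stays at least [e / 4]
     below [m + d] on [U], and averaging over the net lowers the upper bound by [d0]. Otherwise the
     lower bound rises by [d0]. *)
  have [lo|hi] := leP (avg s f 1%g) (m + d / 2).
    exists m => x; rewrite -avg_avg; apply/andP; split.
      by apply: avg_ge => // y; have /andP[] := Hm y.
    rewrite addrA; apply: (avg_le_gap net) => y.
      by have /andP[] := Hm y.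
    by move=> /eqc; rewrite ler_norml; lra.
  exists (m + d0) => x; rewrite -avg_avg; apply/andP; split.
    apply: (avg_ge_gap net) => y.
      by have /andP[] := Hm y.
    by move=> /eqc; rewrite ler_norml; lra.
  rewrite -addrA [d0 + _]addrC subrK.
  by apply: avg_le => // y; have /andP[] := Hm y.
have iter k d : d <= e + d0 *+ k -> D d -> D e.
  elim: k d => [|k IH] d dk Dd.
    have [s [s0 [m Hm]]] := Dd; exists s; split => //; exists m => x.
    by have := Hm x; rewrite mulr0n addr0 in dk *; lra.
  have [de|ed] := leP d e.
    apply: (IH d) => //; apply: (le_trans de); rewrite lerDl.
    by rewrite mulrn_wge0 // ltW.
  apply: (IH (d - d0)); last by apply: step => //; exact: ltW.
  by rewrite mulrSr in dk; lra.
(* The oscillation of [f] is at most [B + B], so [k] gains of [d0] suffice. *)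
have [k _ /(_ _ (leqnn k)) Hk] : \forall k \near \oo, B + B <= k%:R * d0.
  exists (Num.trunc ((B + B) / d0)).+1 => // k /= kB.
  rewrite -ler_pdivrMr //; apply: ltW; apply: (lt_le_trans (truncnS_gt _)).
  by rewrite ler_nat.
apply: (iter k (B + B)).
  rewrite -mulr_natl; lra.
exists [:: 1%g]; split => //; exists (- B) => x.
have := fB x; rewrite /avg big_seq1 mul1g divr1 ler_norml; lra.
Qed.

Lemma ravg_shrink f : continuous f -> forall e, 0 < e ->
  exists s, s != [::] /\ exists m, forall x, m <= ravg s f x <= m + e.
Proof.
move=> cf e e0.
have cfV : continuous (fun x => f x^-1%g).
  move=> x; apply: (@continuous_comp _ _ _ (fun x => x^-1)%g f).
    exact: invg_continuous.
  exact: cf.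
have [s [s0 [m Hm]]] := avg_shrink cfV e0.
exists [seq g^-1 | g <- s]%g; split; first by case: (s) s0.
exists m => x; rewrite ravgE -map_comp (@eq_map _ _ _ id) ?map_id //.
exact: invgK.
Qed.

(* Left averages commute with right averages, and some right average of f is
   almost constant. *)
Lemma avg_le_avg f s t c d : continuous f -> s != [::] -> t != [::] ->
  (forall x, c <= avg s f x) -> (forall x, avg t f x <= d) -> c <= d.
Proof.
move=> cf s0 t0 cs dt; apply/ler_addgt0Pr => e e0.
have [r [r0 [m Hm]]] := ravg_shrink cf e0.
have h1 : c <= m + e.
  apply: (@le_trans _ _ (avg s (ravg r f) 1%g)).
    rewrite avg_ravg ravgE; apply: avg_ge => [|x]; last exact: cs.
    by case: (r) r0.
  by apply: avg_le => // x; have /andP[] := Hm x.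
have h2 : m <= d.
  apply: (@le_trans _ _ (avg t (ravg r f) 1%g)).
    by apply: avg_ge => // x; have /andP[] := Hm x.
  rewrite avg_ravg ravgE; apply: avg_le => [|x]; last exact: dt.
  by case: (r) r0.
lra.
Qed.

(** The normalized Haar integral: for continuous [f] it is the only constant uniformly approximated
    by left averages of [f] ([mean_avg], [mean_unique]). The supremum merely selects it. *)
Definition mean f : R :=
  sup [set c | exists s, s != [::] /\ forall x, c <= avg s f x].

Lemma mean_avg f : continuous f -> forall e, 0 < e ->
  exists2 s, s != [::] & forall x, `|avg s f x - mean f| <= e.
Proof.
move=> cf e e0; have [s [s0 [m Hm]]] := avg_shrink cf e0.
exists s => // x.
set A := [set c | exists s, s != [::] /\ forall x, c <= avg s f x].
have ubA : ubound A (m + e).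
  move=> c [t [t0 ct]]; apply: (avg_le_avg cf t0 s0 ct) => y.
  by have /andP[] := Hm y.
have Am : A m by exists s; split => // y; have /andP[] := Hm y.
have h1 : m <= mean f by apply: ub_le_sup => //; exists (m + e).
have h2 : mean f <= m + e by apply: ge_sup => //; exists m.
have := Hm x; rewrite ler_norml; lra.
Qed.

Lemma mean_unique f c : continuous f ->
  (forall e, 0 < e ->
    exists2 s, s != [::] & forall x, `|avg s f x - c| <= e) ->
  mean f = c.
Proof.
move=> cf H.
have key a b : (forall e, 0 < e ->
    exists2 s, s != [::] & forall x, `|avg s f x - a| <= e) ->
  (forall e, 0 < e ->
    exists2 s, s != [::] & forall x, `|avg s f x - b| <= e) -> a <= b.
  move=> Ha Hb; apply/ler_addgt0Pr => e e0.
  have e20 : 0 < e / 2 by rewrite divr_gt0.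
  have [s s0 sa] := Ha _ e20; have [t t0 tb] := Hb _ e20.
  have : a - e / 2 <= b + e / 2; last lra.
  by apply: (avg_le_avg cf s0 t0) => x; [have := sa x|have := tb x];
    rewrite ler_norml; lra.
by apply/eqP; rewrite eq_le !key // => e; exact: mean_avg.
Qed.

End HaarMean.

(** * Integration theory of the mean: linearity, invariance, strict positivity and Fubini *)

Section ContinuousReal.
Context {R : realType} {T : topologicalType}.
Implicit Types f g : T -> R.

Lemma continuous_funD f g : continuous f -> continuous g ->
  continuous (fun x => f x + g x).
Proof. by move=> cf cg x; apply: cvgD; [exact: cf|exact: cg]. Qed.

Lemma continuous_funM f g : continuous f -> continuous g ->
  continuous (fun x => f x * g x).
Proof. by move=> cf cg x; apply: cvgM; [exact: cf|exact: cg]. Qed.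

Lemma continuous_funZ c f : continuous f -> continuous (fun x => c * f x).
Proof. by apply: continuous_funM => x; exact: cvg_cst. Qed.

Lemma continuous_fun_sum (I : Type) (s : seq I) (F : I -> T -> R) :
  (forall i, continuous (F i)) -> continuous (fun x => \sum_(i <- s) F i x).
Proof.
move=> cF; elim: s => [|i s IH].
  by under eq_fun do rewrite big_nil; move=> x; exact: cvg_cst.
under eq_fun do rewrite big_cons.
by apply: continuous_funD.
Qed.

End ContinuousReal.

Section MeanTheory.
Context {R : realType} {K : topGroupType}.
Hypothesis cK : compact [set: K].
Implicit Types (f : K -> R) (s t : seq K) (e : R).

Lemma continuous_avg s f : continuous f -> continuous (avg s f).
Proof.
move=> cf.
apply: (continuous_funM (f := fun x => \sum_(g <- s) f (g * x)%g)).
  by apply: continuous_fun_sum => g; exact: continuous_translate.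
by move=> x; exact: cvg_cst.
Qed.

Lemma mean_of_avg s f : continuous f -> s != [::] -> mean (avg s f) = mean f.
Proof.
move=> cf s0; symmetry; apply: mean_unique => // e e0.
have [t t0 Ht] := mean_avg cK (continuous_avg (s := s) cf) e0.
exists [seq (g * h)%g | h <- t, g <- s]; first exact: allpairs_neq0.
by move=> x; rewrite -avg_avg.
Qed.

Lemma mean_lin a f (g : K -> R) : continuous f -> continuous g ->
  mean (fun x => a * f x + g x) = a * mean f + mean g.
Proof.
move=> cf cg; apply: mean_unique => //.
  by apply: continuous_funD => //; exact: continuous_funZ.
move=> e e0; set d := e / (`|a| + 1).
have a0 : 0 < `|a| + 1 by rewrite ltr_wpDl.
have d0 : 0 < d by rewrite divr_gt0.
(* Average first by a list good for [f], then by one good for [avg s g]: the second averaging does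
   not spoil the approximation already reached for [f]. *)
have [s s0 Hs] := mean_avg cK cf d0.
have [t t0 Ht] := mean_avg cK (continuous_avg (s := s) cg) d0.
exists [seq (k * h)%g | h <- t, k <- s]; first exact: allpairs_neq0.
move=> x; rewrite avgD avgZ -!avg_avg.
have h1 := avg_dist t0 Hs x.
have h2 := Ht x; rewrite mean_of_avg // in h2.
set u := avg t (avg s f) x in h1 *; set v := avg t (avg s g) x in h2 *.
have -> : a * u + v - (a * mean f + mean g) = a * (u - mean f) + (v - mean g).
  by ring.
have -> : e = `|a| * d + d.
  by rewrite -[X in _ + X]mul1r -mulrDl mulrC divfK ?gt_eqF.
by apply: (le_trans (ler_normD _ _)); rewrite lerD // normrM ler_wpM2l.
Qed.

Lemma mean_cst (c : R) : mean ((fun=> c) : K -> R) = c.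
Proof.
apply: mean_unique => //; first by move=> x; exact: cvg_cst.
move=> e e0; exists [:: 1%g : K] => // x.
by rewrite avg_cst // subrr normr0 ltW.
Qed.

Lemma meanZ a f : continuous f -> mean (fun x => a * f x) = a * mean f.
Proof.
move=> cf; have := @mean_lin a f (fun=> 0) cf (fun=> cvg_cst _).
rewrite mean_cst addr0 => <-.
by congr mean; apply/funext => x; rewrite addr0.
Qed.

Lemma meanD f (g : K -> R) : continuous f -> continuous g ->
  mean (fun x => f x + g x) = mean f + mean g.
Proof.
move=> cf cg; have := mean_lin 1 cf cg; rewrite mul1r => <-.
by congr mean; apply/funext => x; rewrite mul1r.
Qed.

Lemma mean_ge f c : continuous f -> (forall x, c <= f x) -> c <= mean f.
Proof.
move=> cf cle; apply/ler_addgt0Pr => e e0.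
have [s s0 Hs] := mean_avg cK cf e0.
have := Hs 1%g; have := avg_ge s0 cle 1%g; rewrite ler_norml; lra.
Qed.

Lemma mean_le f (g : K -> R) : continuous f -> continuous g ->
  (forall x, f x <= g x) -> mean f <= mean g.
Proof.
move=> cf cg fg; rewrite -subr_ge0 -mulN1r addrC -mean_lin //.
apply: mean_ge => [|x]; last by rewrite mulN1r addrC subr_ge0.
by apply: continuous_funD => //; exact: continuous_funZ.
Qed.

Lemma mean_norm_le f c : continuous f -> (forall x, `|f x| <= c) ->
  `|mean f| <= c.
Proof.
move=> cf fc; rewrite ler_norml; apply/andP; split.
  by apply: mean_ge => // x; have := fc x; rewrite ler_norml => /andP[].
rewrite -[leRHS]mean_cst; apply: mean_le => // [x|x]; first exact: cvg_cst.
by have := fc x; rewrite ler_norml => /andP[].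
Qed.

(** Averaging the translate over [s] is averaging [f] over [h * s], so both functions are
    approximated by the same constants. *)
Lemma mean_translate f h : continuous f ->
  mean (fun x => f (h * x)%g) = mean f.
Proof.
move=> cf; symmetry; apply: mean_unique => // e e0.
have cfh : continuous (fun x => f (h * x)%g) by exact: continuous_translate.
have [s s0 Hs] := mean_avg cK cfh e0.
exists [seq (h * g)%g | g <- s]; first by case: (s) s0.
move=> x; suff -> : avg [seq (h * g)%g | g <- s] f x =
    avg s (fun y => f (h * y)%g) x by exact: Hs.
rewrite /avg size_map big_map; congr (_ / _).
by apply: eq_bigr => g _; rewrite mulgA.
Qed.

Lemma mean_eq0 f : continuous f -> (forall x, 0 <= f x) -> mean f = 0 ->
  forall x, f x = 0.
Proof.
move=> cf f0 mf x0; apply/eqP; rewrite eq_le f0 andbT leNgt; apply/negP => fx0.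
have f20 : 0 < f x0 / 2 by rewrite divr_gt0.
(* On [x0 * U] the function is at least [f x0 / 2]; a net for [U] then bounds some average of the
   translated function, hence its mean, away from [0]. *)
pose U : set K := [set v | forall x, `|f (x * v)%g - f x| <= f x0 / 2].
have nU : nbhs (1%g : K) U := continuous_near_mulgr cK cf f20.
have [s net] := finite_net cK nU.
have s0 : s != [::] by have [g] := net 1%g; case: (s).
pose fx x := f (x0 * x)%g.
have cfx : continuous fx by exact: continuous_translate.
have H : forall x, 0 + f x0 / 2 / (size s)%:R <= avg s fx x.
  apply: (avg_ge_gap net) => x; first exact: f0.
  by move=> /(_ x0); rewrite /fx ler_norml; lra.
have := mean_ge (continuous_avg (s := s) cfx) H.
rewrite mean_of_avg // mean_translate // mf add0r leNgt.
by rewrite divr_gt0 ?size_gt0R.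
Qed.

Lemma continuous_of_near f :
  (forall e, 0 < e -> \forall v \near (1%g : K),
    forall x, `|f (v * x)%g - f x| <= e) -> continuous f.
Proof.
move=> Hf x; apply/cvgrPdist_le => e e0.
have := Hf e e0 => nU.
have : nbhs x ((fun y => y * x^-1)%g @^-1`
    [set v | forall x, `|f (v * x)%g - f x| <= e]).
  apply: (continuous_mulg (a := id) (b := fun=> x^-1%g)) => /=.
  - by move=> ?; exact: cvg_id.
  - by move=> ?; exact: cvg_cst.
  - by rewrite mulgV.
apply: filterS => y /= /(_ x); rewrite mulgVK; by rewrite distrC.
Qed.

Lemma near_mull_kernel (k : K -> K -> R) :
  continuous (fun p : K * K => k p.1 p.2) -> forall e, 0 < e ->
  \forall v \near (1%g : K), forall x y, `|k (v * x)%g y - k x y| <= e.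
Proof.
move=> ck e e0.
have cKK : compact [set: K * K].
  by rewrite -setXTT; exact: compact_setX.
have := @compact_near_uniform R (K * K)%type K
  (fun p v => k (v * p.1)%g p.2) cKK.
have c1 : continuous (fun q : K * K * K => k (q.2 * q.1.1)%g q.1.2).
  move=> q; apply: (@continuous_comp _ _ _
      (fun q : K * K * K => (q.2 * q.1.1, q.1.2)%g)
      (fun p : K * K => k p.1 p.2)); last exact: ck.
  apply: cvg_pair.
    apply: (continuous_mulg (a := fun q : K * K * K => q.2)
      (b := fun q : K * K * K => q.1.1)); first by move=> ?; exact: cvg_snd.
    by move=> z; apply: cvg_comp; [exact: cvg_fst|exact: cvg_fst].
  by apply: cvg_comp; [exact: cvg_fst|exact: cvg_snd].
move=> /(_ c1 e e0); apply: filterS => v H x y.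
by have := H (x, y); rewrite /= mul1g.
Qed.

Lemma continuous_kernelr (k : K -> K -> R) x :
  continuous (fun p : K * K => k p.1 p.2) -> continuous (k x).
Proof.
move=> ck y; apply: (@continuous_comp _ _ _ (fun y : K => (x, y))
  (fun p : K * K => k p.1 p.2)); last exact: ck.
by apply: cvg_pair; [exact: cvg_cst|exact: cvg_id].
Qed.

Lemma continuous_kernel_swap (k : K -> K -> R) :
  continuous (fun p : K * K => k p.1 p.2) ->
  continuous (fun p : K * K => k p.2 p.1).
Proof.
move=> ck q; apply: (@continuous_comp _ _ _ (fun q : K * K => (q.2, q.1))
  (fun p : K * K => k p.1 p.2)); last exact: ck.
by apply: cvg_pair; [exact: cvg_snd|exact: cvg_fst].
Qed.

Lemma mean_dist f (g : K -> R) e : continuous f -> continuous g ->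
  (forall x, `|f x - g x| <= e) -> `|mean f - mean g| <= e.
Proof.
move=> cf cg fg; rewrite -mulN1r addrC -mean_lin //.
apply: mean_norm_le => [|x]; last by rewrite mulN1r addrC.
by apply: continuous_funD => //; exact: continuous_funZ.
Qed.

Lemma continuous_mean_kernel (k : K -> K -> R) :
  continuous (fun p : K * K => k p.1 p.2) -> continuous (fun x => mean (k x)).
Proof.
move=> ck; apply: continuous_of_near => // e e0.
have := near_mull_kernel ck e0; apply: filterS => v Hv x.
by apply: mean_dist => //; exact: continuous_kernelr.
Qed.

Lemma mean_avg_seq (I : eqType) (F : I -> K -> R) (r : seq I) e :
  (forall i, continuous (F i)) -> 0 < e ->
  exists2 s, s != [::] & forall i, i \in r ->
    forall x, `|avg s (F i) x - mean (F i)| <= e.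
Proof.
move=> cF e0; elim: r => [|i r [s s0 IH]]; first by exists [:: 1%g].
have [t t0 Ht] := mean_avg cK (continuous_avg (s := s) (cF i)) e0.
exists [seq (k * h)%g | h <- t, k <- s]; first exact: allpairs_neq0.
move=> j; rewrite inE => /predU1P[->|jr] x; rewrite -avg_avg.
  by have := Ht x; rewrite mean_of_avg.
by apply: avg_dist => // y; exact: IH.
Qed.

Lemma mean_sum (I : Type) (s : seq I) (F : I -> K -> R) :
  (forall i, continuous (F i)) ->
  mean (fun x => \sum_(i <- s) F i x) = \sum_(i <- s) mean (F i).
Proof.
move=> cF; elim: s => [|i s IH].
  by under eq_fun do rewrite big_nil; rewrite big_nil mean_cst.
under eq_fun do rewrite big_cons.
by rewrite big_cons meanD ?IH //; exact: continuous_fun_sum.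
Qed.

(** Replacing the mean in [x] by a finite average makes the exchange plain linearity. The error is
    uniform in [y], since finitely many columns approximate all of them. *)
Lemma mean_exchange (k : K -> K -> R) :
  continuous (fun p : K * K => k p.1 p.2) ->
  mean (fun x => mean (k x)) = mean (fun y => mean (k^~ y)).
Proof.
move=> ck; apply/eqP; rewrite -subr_eq0 -normr_le0.
apply/ler_addgt0Pr => e e0; rewrite add0r.
have e40 : 0 < e / 4 by rewrite divr_gt0.
have csw := continuous_kernel_swap ck.
pose U : set K := [set v | forall y x, `|k x (v * y)%g - k x y| <= e / 4].
have nU : nbhs (1%g : K) U := near_mull_kernel csw e40.
have [r net] := finite_net cK nU.
pose phi x := mean (k x).
have cphi : continuous phi by exact: continuous_mean_kernel.
(* [Some y] codes a column and [None] the function [phi], so one list averages all of them well at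
   once. *)
pose F (o : option K) := if o is Some y then k^~ y else phi.
have ckr y : continuous (k^~ y).
  exact: (continuous_kernelr (k := fun a b => k b a)).
have cF o : continuous (F o) by case: o.
have [s s0 Hs] := mean_avg_seq (None :: map Some r) cF e40.
have Hphi := Hs None (mem_head _ _) 1%g; rewrite /F in Hphi.
pose psi y := avg s (k^~ y) 1%g.
have cpsi : continuous psi.
  apply: (continuous_funM (g := fun=> (size s)%:R^-1)).
    by apply: continuous_fun_sum => g; exact: continuous_kernelr.
  by move=> x; exact: cvg_cst.
have psi_phi : mean psi = avg s phi 1%g.
  rewrite /psi /avg; under eq_fun do rewrite mulrC.
  rewrite meanZ; last first.
    by apply: continuous_fun_sum => g; exact: continuous_kernelr.
  rewrite (@mean_sum K s (fun g => k (g * 1)%g)); first by rewrite mulrC.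
  by move=> g; exact: continuous_kernelr.
have h y : `|psi y - mean (k^~ y)| <= 3 * (e / 4).
  have [g gr Ug] := net y^-1%g.
  have {}Ug x : `|k x g - k x y| <= e / 4 by have := Ug y x; rewrite mulgVK.
  have h1 : `|psi y - avg s (k^~ g) 1%g| <= e / 4.
    have -> : psi y - avg s (k^~ g) 1%g =
        - (avg s (fun x => k x g - k x y) 1%g - 0).
      by rewrite avgD avgN subr0 opprB.
    by rewrite normrN; apply: avg_dist => // x; rewrite subr0.
  have h2 : `|avg s (k^~ g) 1%g - mean (k^~ g)| <= e / 4.
    by apply: (Hs (Some g)); rewrite inE map_f.
  have h3 : `|mean (k^~ g) - mean (k^~ y)| <= e / 4 by exact: mean_dist.
  by move: h1 h2 h3; rewrite !ler_norml; lra.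
have := mean_dist cpsi (continuous_mean_kernel csw) h.
by move: Hphi; rewrite psi_phi !ler_norml; lra.
Qed.

End MeanTheory.

(** * Compactness of equicontinuous families *)

(** Arzela-Ascoli for a family [S d] shrinking with [d], in place of a sequence: Tychonoff gives a
    pointwise cluster point, and equicontinuity makes the approximation uniform. *)
Lemma uniform_cluster (R : realType) (K : topGroupType)
    (S : R -> set (K -> R)) (C : R) :
  compact [set: K] ->
  (forall d, 0 < d -> S d !=set0) ->
  (forall d d', d <= d' -> S d `<=` S d') ->
  (forall d f, S d f -> forall x, `|f x| <= C) ->
  (forall e, 0 < e -> \forall v \near (1%g : K),
    forall d f, S d f -> forall x, `|f (v * x)%g - f x| <= e) ->
  exists g : K -> R, forall e, 0 < e ->
    exists2 f, S e f & forall x, `|f x - g x| <= e.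
Proof.
move=> cK S0 Smono SC Seq.
pose PT : topologicalType := prod_topology (fun _ : K => R).
pose F := filter_from [set d : R | 0 < d] S.
have FF : Filter F.
  apply: filter_from_filter; first by exists 1 => /=.
  move=> d d' /= d0 d'0; exists (Num.min d d').
    by rewrite /= lt_min d0.
  by move=> f Sf; split; apply: Smono Sf; rewrite ge_min lexx // orbT.
have PF : ProperFilter F by exact: filter_from_proper.
have cA (x : K) : compact [set` `[- C, C]] by exact: segment_compact.
have [|g [_ gF]] := @tychonoff K (fun=> R) (fun=> [set` `[- C, C]]) cA F PF.
  exists 1 => //= f Sf x /=.
  by rewrite in_itv /=; have := SC _ _ Sf x; rewrite ler_norml.
exists g => e e0.
have e30 : 0 < e / 3 by rewrite divr_gt0.
have pointwise (r : seq K) d : 0 < d ->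
    exists2 f, S d f & forall x, x \in r -> `|f x - g x| <= d.
  move=> d0.
  have nr : nbhs (g : PT)
      [set f | forall x, x \in r -> `|f x - g x| <= d].
    elim: r => [|x r IH].
      by apply: filterE => f x; rewrite in_nil.
    have nb : nbhs (g x) [set y : R | `|y - g x| <= d].
      have /cvgrPdist_le/(_ _ d0) := @cvg_id _ (nbhs (g x)).
      by apply: filterS => y; rewrite distrC.
    have nx : nbhs (g : PT) [set f : PT | `|f x - g x| <= d].
      exact: (@proj_continuous K (fun=> R) x g _ nb).
    apply: filterS2 nx IH => f fx fr y.
    by rewrite inE => /predU1P[->|/fr].
  have [f [Sf fr]] := gF _ _ (ex_intro2 _ _ d d0 (fun _ => id)) nr.
  by exists f.
have nU := Seq _ e30.
have [r net] := finite_net cK nU.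
have close d f x h : S d f -> (forall d f, S d f ->
    forall y, `|f (h * x^-1 * y)%g - f y| <= e / 3) ->
    `|f h - f x| <= e / 3.
  by move=> Sf /(_ _ _ Sf x); rewrite mulgVK.
(* The limit inherits the modulus of continuity by approximating it at the two points [x] and [h]
   only. *)
have gclose x h : (forall d f, S d f ->
    forall y, `|f (h * x^-1 * y)%g - f y| <= e / 3) ->
    `|g h - g x| <= e / 3.
  move=> H; apply/ler_addgt0Pr => d d0.
  have d20 : 0 < d / 2 by rewrite divr_gt0.
  have [f Sf fg] := pointwise [:: x; h] _ d20.
  have := fg x (mem_head _ _); have := fg h.
  rewrite !inE eqxx orbT => /(_ isT).
  have := close _ f x h Sf H.
  by rewrite !ler_norml; lra.
have [f Sf fg] := pointwise r _ e30.
exists f; first by apply: Smono Sf; lra.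
(* Go from [f x] to [f h], [g h] and [g x] through a net point [h], at cost [e / 3] each. *)
move=> x; have [h hr Uh] := net x^-1%g.
have := close _ f x h Sf Uh; have := gclose x h Uh; have := fg h hr.
by rewrite !ler_norml; lra.
Qed.

(** * The L2 inner product and symmetric convolution operators *)

Section Convolution.
Context {R : realType} {K : topGroupType}.
Hypothesis cK : compact [set: K].
Implicit Types (f w : K -> R) (e : R).

Definition ip f w : R := mean (fun x => f x * w x).

Lemma ipC f w : ip f w = ip w f.
Proof. by congr mean; apply/funext => x; rewrite mulrC. Qed.

Lemma ip_linl a f (f' : K -> R) w : continuous f -> continuous f' ->
  continuous w -> ip (fun x => a * f x + f' x) w = a * ip f w + ip f' w.
Proof.
move=> cf cf' cw; rewrite -mean_lin //; try exact: continuous_funM.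
by congr mean; apply/funext => x; rewrite mulrDl mulrA.
Qed.

Lemma ip_linr a f (f' : K -> R) w : continuous f -> continuous f' ->
  continuous w -> ip w (fun x => a * f x + f' x) = a * ip w f + ip w f'.
Proof. by move=> cf cf' cw; rewrite ipC ip_linl // ![ip w _]ipC. Qed.

Lemma ip_ge0 f : continuous f -> 0 <= ip f f.
Proof.
move=> cf; apply: (mean_ge cK) => [|x]; first exact: continuous_funM.
by rewrite -expr2 sqr_ge0.
Qed.

Lemma ip_eq0 f : continuous f -> ip f f = 0 -> forall x, f x = 0.
Proof.
move=> cf f0 x; apply/eqP; rewrite -sqrf_eq0 expr2; apply/eqP.
apply: (mean_eq0 cK (f := fun x => f x * f x)) => //.
  exact: continuous_funM.
by move=> y; rewrite -expr2 sqr_ge0.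
Qed.

(* AM-GM on [|f|] replaces the Cauchy-Schwarz inequality. *)
Lemma mean_mul_bound w f c t : continuous w -> continuous f -> 0 < t ->
  (forall x, `|w x| <= c) ->
  `|mean (fun x => w x * f x)| <= c * ((t + t^-1 * ip f f) / 2).
Proof.
move=> cw cf t0 wc.
have c0 : 0 <= c by exact: le_trans (wc 1%g).
pose b x := c / 2 * t^-1 * (f x * f x) + c / 2 * t.
have cff : continuous (fun x => f x * f x) by exact: continuous_funM.
have cb : continuous b.
  apply: continuous_funD; first exact: continuous_funZ.
  by move=> x; exact: cvg_cst.
have cwf : continuous (fun x => w x * f x) by exact: continuous_funM.
have mb : mean b = c * ((t + t^-1 * ip f f) / 2).
  rewrite /b (mean_lin cK) //; last by move=> x; exact: cvg_cst.
  by rewrite (mean_cst cK) /ip; lra.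
have wb x : `|w x * f x| <= b x.
  have h : `|f x| <= (t^-1 * (f x * f x) + t) / 2.
    have -> : t^-1 * (f x * f x) + t = t^-1 * (`|f x| * `|f x| + t * t).
      by rewrite -normrM ger0_norm -?expr2 ?sqr_ge0 // mulrDr !expr2
        mulKf ?gt_eqF.
    rewrite -mulrA mulrC ler_pdivlMr // ler_pdivlMr //.
    have := sqr_ge0 (`|f x| - t); rewrite expr2; nra.
  rewrite normrM; apply: le_trans (ler_pM _ _ (wc x) h) _ => //.
  by rewrite /b; lra.
rewrite -mb ler_norml; apply/andP; split.
  rewrite -mulN1r -(meanZ cK) //; apply: (mean_le cK) => // [|x].
    exact: continuous_funZ.
  by have := wb x; rewrite ler_norml mulN1r => /andP[].
by apply: (mean_le cK) => // x; have := wb x; rewrite ler_norml => /andP[].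
Qed.

Variable u : K -> R.
Hypothesis cu : continuous u.
Hypothesis uV : forall x, u x^-1%g = u x.

Definition conv f : K -> R := fun x => mean (fun y => u (x^-1 * y)%g * f y).

Lemma continuous_conv_kernel : continuous (fun p : K * K => u (p.1^-1 * p.2)%g).
Proof.
move=> p; apply: (@continuous_comp _ _ _ (fun p : K * K => p.1^-1 * p.2)%g u).
  apply: (continuous_mulg (a := fun p : K * K => (p.1^-1)%g)
    (b := fun p : K * K => p.2)); last by move=> ?; exact: cvg_snd.
  by apply: continuous_invg => ?; exact: cvg_fst.
exact: cu.
Qed.

Lemma continuous_kernel_row x : continuous (fun y => u (x^-1 * y)%g).
Proof. apply: (continuous_kernelr (k := fun x y => u (x^-1 * y)%g)).
exact: continuous_conv_kernel. Qed.

Lemma continuous_conv f : continuous f -> continuous (conv f).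
Proof.
move=> cf.
apply: (continuous_mean_kernel cK (k := fun x y => u (x^-1 * y)%g * f y)).
apply: continuous_funM; first exact: continuous_conv_kernel.
by move=> p; apply: continuous_comp; [exact: cvg_snd|exact: cf].
Qed.

Lemma conv_lin a f w x : continuous f -> continuous w ->
  conv (fun y => a * f y + w y) x = a * conv f x + conv w x.
Proof.
move=> cf cw; rewrite /conv -(mean_lin cK); last 2 first.
- by apply: continuous_funM => //; exact: continuous_kernel_row.
- by apply: continuous_funM => //; exact: continuous_kernel_row.
by congr mean; apply/funext => y; ring.
Qed.

(** By [uV] the kernel [u (x^-1 * y)] is symmetric in [x] and [y]; the rest is Fubini. *)
Lemma conv_sym f w : continuous f -> continuous w ->
  ip (conv f) w = ip f (conv w).
Proof.
move=> cf cw.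
transitivity (mean (fun x => mean (fun y => w x * u (x^-1 * y)%g * f y))).
  congr mean; apply/funext => x; rewrite mulrC /conv -(meanZ cK).
    by congr mean; apply/funext => y; rewrite mulrA.
  by apply: continuous_funM => //; exact: continuous_kernel_row.
rewrite (mean_exchange cK (k := fun x y => w x * u (x^-1 * y)%g * f y)).
  congr mean; apply/funext => y; rewrite /conv -(meanZ cK).
    congr mean; apply/funext => x.
    by rewrite -[in RHS]uV invgM invgK; ring.
  by apply: continuous_funM => //; exact: continuous_kernel_row.
apply: continuous_funM; last first.
  by move=> p; apply: continuous_comp; [exact: cvg_snd|exact: cf].
apply: continuous_funM; last exact: continuous_conv_kernel.
by move=> p; apply: continuous_comp; [exact: cvg_fst|exact: cw].
Qed.

Lemma conv_translate f h x : continuous f ->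
  conv (fun y => f (h * y)%g) x = conv f (h * x)%g.
Proof.
move=> cf; rewrite /conv -[RHS](mean_translate cK h).
  by congr mean; apply/funext => y; rewrite invgM -mulgA mulKg.
by apply: continuous_funM => //; exact: continuous_kernel_row.
Qed.

Lemma conv_bound c t f : 0 < t -> (forall x, `|u x| <= c) -> continuous f ->
  forall x, `|conv f x| <= c * ((t + t^-1 * ip f f) / 2).
Proof.
move=> t0 uc cf x; apply: mean_mul_bound => //.
exact: continuous_kernel_row.
Qed.

Lemma conv_bound_sup c b f : (forall x, `|u x| <= c) -> continuous f ->
  (forall x, `|f x| <= b) -> forall x, `|conv f x| <= c * b.
Proof.
move=> uc cf fb x; apply: (mean_norm_le cK) => [|y].
  by apply: continuous_funM => //; exact: continuous_kernel_row.
by rewrite normrM ler_pM.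
Qed.

Lemma conv_translate_sub f v x : continuous f ->
  conv f (v * x)%g - conv f x =
  mean (fun y => (u ((v * x)^-1 * y)%g - u (x^-1 * y)%g) * f y).
Proof.
move=> cf; rewrite /conv addrC -mulN1r -(mean_lin cK); last 2 first.
- by apply: continuous_funM => //; exact: continuous_kernel_row.
- by apply: continuous_funM => //; exact: continuous_kernel_row.
by congr mean; apply/funext => y; ring.
Qed.

Lemma continuous_kernel_row_sub x x' :
  continuous (fun y => u (x'^-1 * y)%g - u (x^-1 * y)%g).
Proof.
by move=> y; apply: cvgB; exact: continuous_kernel_row.
Qed.

(** The modulus of continuity of [conv f] comes from the kernel alone. The L2 form gives the
    equicontinuity needed for extracting a limit, the sup-norm form the continuity of the action on
    an eigenspace. *)
Lemma near_conv_translate e : 0 < e -> \forall v \near (1%g : K),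
  (forall f, continuous f -> ip f f <= 1 ->
    forall x, `|conv f (v * x)%g - conv f x| <= e) /\
  (forall f b, continuous f -> (forall x, `|f x| <= b) ->
    forall x, `|conv f (v * x)%g - conv f x| <= e * b).
Proof.
move=> e0; have := near_mull_kernel cK (k := fun x y => u (x^-1 * y)%g)
  continuous_conv_kernel e0.
apply: filterS => v Hv; split => [f cf f1 x|f b cf fb x];
  rewrite conv_translate_sub //.
  have := @mean_mul_bound _ f e 1 (@continuous_kernel_row_sub x (v * x)%g) cf
    ltr01 (Hv x).
  by move=> /le_trans; apply; rewrite invr1 mul1r; nra.
apply: (mean_norm_le cK) => [|y].
  by apply: continuous_funM => //; exact: continuous_kernel_row_sub.
by rewrite normrM ler_pM.
Qed.

Lemma ip_conv_conv_sub l f : continuous f ->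
  ip (fun x => - l * f x + conv (conv f) x)
    (fun x => - l * f x + conv (conv f) x)
  = ip (conv (conv f)) (conv (conv f)) - 2 * l * ip (conv f) (conv f)
    + l ^+ 2 * ip f f.
Proof.
move=> cf; have c1 := continuous_conv cf; have c2 := continuous_conv c1.
have c3 : continuous (fun x => - l * f x + conv (conv f) x).
  by apply: continuous_funD => //; exact: continuous_funZ.
rewrite ip_linl // !ip_linr // (ipC f (conv (conv f))) conv_sym //; ring.
Qed.

End Convolution.

(** * Eigenfunctions of the squared convolution operator *)

Section Eigenfunctions.
Context {R : realType} {K : topGroupType}.
Hypothesis cK : compact [set: K].
Implicit Types (f w : K -> R) (e : R).

Lemma continuous_uniform_limit (g : K -> R) :
  (forall e, 0 < e -> exists2 f, continuous f & forall x, `|f x - g x| <= e) ->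
  continuous g.
Proof.
move=> H; apply: continuous_of_near => e e0.
have e30 : 0 < e / 3 by rewrite divr_gt0.
have [f cf fg] := H _ e30.
have ck : continuous (fun p : K * K => f p.1).
  by move=> p; apply: continuous_comp; [exact: cvg_fst|exact: cf].
have := near_mull_kernel cK (k := fun x _ => f x) ck e30.
apply: filterS => v Hv x; have := Hv x 1%g; have := fg x.
by have := fg (v * x)%g; rewrite !ler_norml; lra.
Qed.

Lemma ipZ a f : continuous f ->
  ip (fun x => a * f x) (fun x => a * f x) = a ^+ 2 * ip f f.
Proof.
move=> cf; rewrite /ip -(meanZ cK); last exact: continuous_funM.
by congr mean; apply/funext => x; ring.
Qed.

Lemma ip_le_sup f b : continuous f -> (forall x, `|f x| <= b) ->
  ip f f <= b ^+ 2.
Proof.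
move=> cf fb; rewrite -(mean_cst cK (b ^+ 2)); apply: (mean_le cK).
- exact: continuous_funM.
- by move=> x; exact: cvg_cst.
- by move=> x; rewrite -expr2 -real_normK ?num_real // lerXn2r ?nnegrE //;
    exact: le_trans (fb x).
Qed.

Variable u : K -> R.
Hypothesis cu : continuous u.
Hypothesis uV : forall x, u x^-1%g = u x.

(** Here [l] is the supremum of the squared norm of [conv u f] over the unit ball of [V], and [g] a
    uniform cluster point of [conv u f] for near maximizers [f]. Maximizing a norm yields an
    eigenvalue of the square, which is positive whatever the sign for [conv u] itself. *)
Lemma conv_eigenfunction (V : set (K -> R)) :
  (forall f, V f -> continuous f) ->
  (forall a f, V f -> V (fun x => a * f x)) ->
  (forall f, V f -> V (conv u f)) ->
  (forall g, (forall e, 0 < e ->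
    exists2 f, V f & forall x, `|f x - g x| <= e) -> V g) ->
  (exists2 f, V f & exists x, conv u f x != 0) ->
  exists g l, [/\ V g, 0 < l, forall x, conv u (conv u g) x = l * g x &
    exists x, g x != 0].
Proof.
move=> Vc VZ VT Vlim [f0 Vf0 [x0 Tf0]].
have cT f : V f -> continuous (conv u f) by move=> /Vc; exact: continuous_conv.
have [c uc] := continuous_bounded cK cu.
have c0 : 0 <= c by exact: le_trans (uc 1%g).
have Tc f : V f -> ip f f <= 1 -> forall x, `|conv u f x| <= c.
  move=> Vf f1 x; have := conv_bound cK cu ltr01 uc (Vc _ Vf) x.
  by move=> /le_trans; apply; rewrite invr1 mul1r; nra.
pose A := [set r | exists2 f, V f /\ ip f f <= 1 &
  r = ip (conv u f) (conv u f)].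
have ubA : ubound A (c ^+ 2).
  move=> _ [f [Vf f1] ->]; apply: ip_le_sup; first exact: cT.
  exact: Tc.
pose l := sup A.
have lA f : V f -> ip f f <= 1 -> ip (conv u f) (conv u f) <= l.
  by move=> Vf f1; apply: ub_le_sup; [exists (c ^+ 2)|exists f].
have TZ a f x : V f -> conv u (fun y => a * f y) x = a * conv u f x.
  move=> Vf; rewrite /conv -(meanZ cK).
    by congr mean; apply/funext => y; ring.
  apply: continuous_funM; last exact: Vc.
  exact: continuous_kernel_row.
have l0 : 0 < l.
  (* This factor brings [f0] into the unit ball without a square root: [a ^+ 2 * ip f0 f0 <= a * (1
     + ip f0 f0) = 1]. *)
  pose a := (1 + ip f0 f0)^-1.
  have q0 := ip_ge0 cK (Vc _ Vf0).
  have a0 : 0 < a by rewrite invr_gt0 ltr_wpDr.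
  have a1 : a <= 1 by rewrite invf_le1 ?lerDl // ltr_wpDr.
  have aq : a ^+ 2 * ip f0 f0 <= 1.
    have aE : a * (1 + ip f0 f0) = 1 by rewrite mulVf // gt_eqF // ltr_wpDr.
    by rewrite expr2; nra.
  apply: lt_le_trans (lA (fun x => a * f0 x) (VZ _ _ Vf0) _); last first.
    by rewrite ipZ //; exact: Vc.
  have -> : conv u (fun x => a * f0 x) = fun x => a * conv u f0 x.
    by apply/funext => x; exact: TZ.
  rewrite ipZ; last exact: cT.
  rewrite mulr_gt0 ?exprn_gt0 // lt_neqAle (ip_ge0 cK (cT _ Vf0)) andbT.
  rewrite eq_sym; apply/eqP => /(ip_eq0 cK (cT _ Vf0)) /(_ x0) T0.
  by rewrite T0 eqxx in Tf0.
have Tle f : V f -> ip (conv u f) (conv u f) <= l * ip f f.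
  move=> Vf; have [q0|q0] := eqVneq (ip f f) 0.
    have f00 : f = fun x => 0 * f x.
      by apply/funext => x; rewrite mul0r (ip_eq0 cK (Vc _ Vf) q0).
    have -> : conv u f = fun x => 0 * conv u f x.
      by rewrite [in LHS]f00; apply/funext => x; exact: TZ.
    rewrite ipZ; last exact: cT.
    by rewrite expr0n mul0r q0 mulr0.
  have qp : 0 < ip f f by rewrite lt_neqAle eq_sym q0 ip_ge0 //; exact: Vc.
  pose a := (Num.sqrt (ip f f))^-1.
  have a2 : a ^+ 2 = (ip f f)^-1 by rewrite exprVn sqr_sqrtr // ltW.
  have := lA (fun x => a * f x) (VZ _ _ Vf).
  have -> : conv u (fun x => a * f x) = fun x => a * conv u f x.
    by apply/funext => x; exact: TZ.
  rewrite !ipZ; [|exact: cT|exact: Vc].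
  rewrite a2 mulVf // => /(_ (lexx _)).
  by rewrite mulrC ler_pdivrMr.
pose S d := [set w | exists2 f, w = conv u f &
  [/\ V f, ip f f <= 1 & l - d <= ip (conv u f) (conv u f)]].
have [||||g gS] := @uniform_cluster R K S c cK.
- move=> d d0.
  have [|_ [f [Vf f1] ->] lf] := @sup_adherent _ A d d0.
    split; last by exists (c ^+ 2).
    exists (ip (conv u (fun x => 0 * f0 x)) (conv u (fun x => 0 * f0 x))).
    exists (fun x => 0 * f0 x) => //; split; first exact: VZ.
    by rewrite ipZ ?expr0n ?mul0r //; exact: Vc.
  by exists (conv u f); exists f => //; split => //; exact: ltW.
- move=> d d' dd' _ [f -> [Vf f1 lf]]; exists f => //; split => //.
  by apply: le_trans lf; lra.
- by move=> d _ [f -> [Vf f1 _]]; exact: Tc.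
- move=> e e0; have := near_conv_translate cK cu e0.
  apply: filterS => v [Hv _] d _ [f -> [Vf f1 _]].
  by apply: Hv => //; exact: Vc.
have Vg : V g.
  apply: Vlim => e /gS [_ [f -> [Vf _ _]] fg].
  by exists (conv u f) => //; exact: VT.
have cg := Vc _ Vg.
exists g, l; split => //.
- move=> x; apply/eqP; rewrite -subr_eq0 -normr_le0.
  (* The three terms bound, up to the factor [s], the errors from replacing [conv u f] by [g] under
     the squared operator, from the same replacement in [l * g], and from [f] being only an
     approximate eigenfunction. *)
  pose M := c ^+ 2 + l + c * ((1 + l) / 2).
  have M0 : 0 <= M.
    apply: addr_ge0; first by apply: addr_ge0; [exact: sqr_ge0|exact: ltW].
    by apply: mulr_ge0 => //; have := ltW l0; lra.
  suff key (s : R) : 0 < s -> s <= 1 ->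
      `|conv u (conv u g) x - l * g x| <= s * M.
    apply/ler_addgt0Pr => e e0; rewrite add0r.
    pose s := Num.min 1 (e / (M + 1)).
    have M1 : 0 < M + 1 by rewrite ltr_wpDl.
    have s0 : 0 < s by rewrite lt_min ltr01 divr_gt0.
    apply: le_trans (key s s0 _) _; first by rewrite ge_min lexx.
    have : s <= e / (M + 1) by rewrite ge_min lexx orbT.
    by rewrite ler_pdivlMr // mulrDr mulr1; lra.
  move=> s0 s1.
  have s20 : 0 < s ^+ 2 by rewrite exprn_gt0.
  (* Tolerance [s ^+ 2] on squared norms leaves an error of order [s] in norm; the free parameter of
     [conv_bound] is set to [s] accordingly. *)
  have [_ [f -> [Vf f1 lf]] fg] := gS _ s20.
  have cf := Vc _ Vf.
  set Tf := conv u f in fg lf *.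
  have VTf : V Tf by exact: VT.
  have VTTf : V (conv u Tf) by exact: VT.
  (* f is an approximate eigenfunction: since |T^2 f|^2 <= l |T f|^2,
     |T^2 f - l f|^2 <= l (l - |T f|^2). *)
  pose w y := - l * f y + conv u Tf y.
  have cw : continuous w.
    by apply: continuous_funD; [exact: continuous_funZ|exact: Vc].
  have qw : ip w w <= l * s ^+ 2.
    rewrite /w ip_conv_conv_sub // -/Tf.
    have := Tle Tf VTf; have := ip_ge0 cK cf.
    set q := ip f f in f1 *; set q1 := ip Tf Tf in lf *.
    set q2 := ip _ _ => q0 q12; nra.
  have h1 : `|conv u w x| <= c * (s * ((1 + l) / 2)).
    apply: le_trans (conv_bound cK cu s0 uc cw x) _.
    have qs : s^-1 * ip w w <= l * s.
      by rewrite mulrC ler_pdivrMr // -mulrA -expr2.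
    by rewrite ler_wpM2l //; lra.
  have wE : conv u w x = conv u (conv u Tf) x - l * Tf x.
    rewrite /w (conv_lin cK cu); [|exact: cf|exact: Vc].
    by rewrite mulNr addrC.
  have cd : continuous (fun y => -1 * g y + Tf y).
    by apply: continuous_funD; [exact: continuous_funZ|exact: Vc].
  have h2 : `|conv u (conv u Tf) x - conv u (conv u g) x| <= c * (c * s ^+ 2).
    have -> : conv u (conv u Tf) x - conv u (conv u g) x =
        conv u (conv u (fun y => -1 * g y + Tf y)) x.
      have -> : conv u (fun y => -1 * g y + Tf y) =
          fun y => -1 * conv u g y + conv u Tf y.
        by apply/funext => y; rewrite (conv_lin cK cu) //; exact: Vc.
      by rewrite (conv_lin cK cu); [rewrite mulN1r addrC|exact: cT|exact: cT].
    apply: (conv_bound_sup cK cu uc); first exact: continuous_conv.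
    apply: (conv_bound_sup cK cu uc) => // y.
    by rewrite mulN1r addrC.
  have h3 : `|l * Tf x - l * g x| <= l * s ^+ 2.
    by rewrite -mulrBr normrM gtr0_norm // ler_wpM2l // ltW.
  have ss : s ^+ 2 <= s by rewrite expr2 -[leRHS]mulr1 ler_wpM2l // ltW.
  have h4 : c * (c * s ^+ 2) <= s * c ^+ 2.
    by rewrite mulrA -expr2 mulrC ler_wpM2r // sqr_ge0.
  have h5 : l * s ^+ 2 <= s * l by rewrite mulrC ler_wpM2r // ltW.
  have h6 : c * (s * ((1 + l) / 2)) = s * (c * ((1 + l) / 2)) by ring.
  rewrite wE h6 in h1; rewrite /M !mulrDr.
  move: h1 (le_trans h2 h4) (le_trans h3 h5).
  set p := s * (c * _); rewrite !ler_norml; lra.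
- apply/not_existsP => g0.
  have {}g0 x : g x = 0 by apply/eqP/negPn/negP => /(g0 x).
  (* If [g] vanished, a near maximizer would give [l - e <= e ^+ 2 <= e], hence
     [l <= 2 * e <= 2 * l / 3]. *)
  pose e := Num.min 1 (l / 3).
  have l30 : 0 < l / 3 by rewrite divr_gt0.
  have e0 : 0 < e by rewrite lt_min ltr01.
  have e1 : e <= 1 by rewrite ge_min lexx.
  have el : e <= l / 3 by rewrite ge_min lexx orbT.
  have [_ [f -> [Vf f1 lf]] fg] := gS e e0.
  have : ip (conv u f) (conv u f) <= e ^+ 2.
    apply: ip_le_sup; first exact: cT.
    by move=> x; have := fg x; rewrite g0 subr0.
  rewrite expr2; nra.
Qed.

End Eigenfunctions.

(** * Equicontinuous actions, separation of points, and the absence of small subgroups *)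

(** The product law is imposed only as seen by functions in [E], so that a quotient group can act
    through the representatives [qrepr], which need not be multiplicative. The unit law follows in
    [equicontinuous_action1]. The last field is continuity at [1] in operator norm. *)
Record equicontinuous_action (R : realType) (G : topGroupType) (X : Type)
    (act : G -> X -> X) (E : set (X -> R)) : Prop := EquicontinuousAction {
  equiact_sub : forall f f', E f -> E f' -> E (fun x => f x - f' x) ;
  equiact_act : forall g f, E f -> E (fun x => f (act g x)) ;
  equiact_mul : forall g h f x, E f ->
    f (act (g * h)%g x) = f (act g (act h x)) ;
  equiact_bounded : forall f, E f -> exists b, forall x, `|f x| <= b ;
  equiact_near : forall e, 0 < e -> \forall g \near (1%g : G),
    forall f b, E f -> (forall x, `|f x| <= b) ->
    forall x, `|f (act g x) - f x| <= e * b }.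

Lemma compact_group_separation (R : realType) (K : topGroupType) (a : K) :
  compact [set: K] -> a != 1%g ->
  exists2 E : set (K -> R), equicontinuous_action (fun h x => h * x)%g E &
    exists2 f, E f & exists x, f (a * x)%g != f x.
Proof.
move=> cK a1.
have [u [cu uV u1 ua]] : exists u : K -> R, [/\ continuous u,
    forall x, u x^-1%g = u x, u 1%g = 1 & u a = 0].
  have aK := hausdorff_accessible (@topgroup_hausdorff K).
  have nK := compact_normal (@topgroup_hausdorff K) cK.
  have cl1 : closed [set (1%g : K)] by exact: accessible_closed_set1.
  have := normal_completely_regular (R := R) nK aK cl1 (a := a).
  move=> /(_ (elimN eqP a1)) /(@uniform_separatorP K R) [v [cv _ va v1]].
  have {}va : v a = 0 by apply: va; exists a.
  have {}v1 : v 1%g = 1 by apply: v1; exists 1%g.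
  (* The product with the inverted function makes the Urysohn function symmetric and keeps its
     values at [1] and [a]. *)
  exists (fun x => v x * v x^-1%g); split.
  - apply: continuous_funM => // x.
    apply: (@continuous_comp _ _ _ (fun x => x^-1)%g v); last exact: cv.
    exact: invg_continuous.
  - by move=> x; rewrite invgK mulrC.
  - by rewrite invg1 v1 mulr1.
  - by rewrite va mul0r.
pose fixed (w : K -> R) := continuous w /\ forall x, w (a * x)%g = w x.
pose V := [set f : K -> R | continuous f /\ forall w, fixed w -> ip f w = 0].
have [|||||g [l [[cg Vg] l0 eig [x0 gx0]]]] :=
    @conv_eigenfunction R K cK u cu uV V.
- by move=> f [].
- move=> b f [cf Vf]; split; first exact: continuous_funZ.
  move=> w fw; have := Vf w fw; rewrite /ip => h.
  rewrite -[RHS](mulr0 b) -h -(meanZ cK).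
    by congr mean; apply/funext => x; rewrite mulrA.
  by apply: continuous_funM => //; case: fw.
- move=> f [cf Vf]; split; first exact: continuous_conv.
  move=> w [cw aw]; rewrite conv_sym //; apply: Vf; split.
    exact: continuous_conv.
  move=> x; rewrite -(conv_translate cK cu) //.
  by congr (conv u _ x); apply/funext => y; exact: aw.
- move=> g gV.
  have cg : continuous g.
    by apply: continuous_uniform_limit => // e /gV[f [cf _] fg]; exists f.
  split=> // w fw; have cw := fw.1; have [b wb] := continuous_bounded cK cw.
  apply/eqP; rewrite -normr_le0; apply/ler_addgt0Pr => e e0; rewrite add0r.
  have b0 : 0 <= b by exact: le_trans (wb 1%g).
  have b1 : 0 < b + 1 by rewrite ltr_wpDl.
  have [f [cf Vf] fg] := gV (e / (b + 1)) (divr_gt0 e0 b1).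
  have := mean_dist cK (e := e) (continuous_funM cf cw) (continuous_funM cg cw).
  rewrite -/(ip f w) -/(ip g w) Vf // sub0r normrN; apply => x.
  rewrite -mulrBl normrM.
  have -> : e = e / (b + 1) * (b + 1) by rewrite divfK ?gt_eqF.
  by apply: ler_pM => //; rewrite (le_trans (wb x)) // lerDl.
(* This [f] lies in [V] by invariance of the mean. Its squared norm is [conv u f 1 - conv u f a^-1],
   so [conv u f = 0] would force [f = 0], although [f 1 = u 1 - u a = 1]. *)
- pose f y := -1 * u (a * y)%g + u y.
  have cua := continuous_translate (h := a) cu.
  have cf : continuous f.
    by apply: continuous_funD => //; exact: continuous_funZ.
  exists f.
    split=> // w [cw aw]; rewrite /f ip_linl // mulN1r addrC.
    rewrite /ip -(mean_translate cK a (f := fun x => u x * w x)).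
      by rewrite -[RHS](subrr (mean (fun x => u (a * x)%g * w x)));
        congr (mean _ - _); apply/funext => x; rewrite aw.
    exact: continuous_funM.
  apply: contrapT => /forallNP T0.
  have {}T0 x : conv u f x = 0 by apply/eqP/negPn/negP => /(T0 x).
  have : ip f f = 0.
    rewrite {1}/f ip_linl //.
    have -> : ip (fun y => u (a * y)%g) f = conv u f a^-1%g.
      by congr mean; apply/funext => y; rewrite invgK.
    have -> : ip u f = conv u f 1%g.
      by congr mean; apply/funext => y; rewrite invg1 mul1g.
    by rewrite !T0 mulr0 addr0.
  move=> /(ip_eq0 cK cf) /(_ 1%g).
  by rewrite /f mulg1 ua u1 mulr0 add0r => /eqP; rewrite oner_eq0.
pose E := [set f : K -> R | continuous f /\
  forall x, conv u (conv u f) x = l * f x].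
exists E; last first.
  exists g; first by [].
  (* Were [g] fixed by [a], it would be orthogonal to itself and vanish. *)
  apply: contrapT => /forallNP ga.
  have {}ga x : g (a * x)%g = g x by apply/eqP/negPn/negP => /(ga x).
  have /(ip_eq0 cK cg)/(_ x0) := Vg g (conj cg ga).
  by apply/eqP.
split.
- move=> f f' [cf Ef] [cf' Ef'].
  have -> : (fun x => f x - f' x) = fun x => -1 * f' x + f x.
    by apply/funext => x; rewrite mulN1r addrC.
  split; first by apply: continuous_funD => //; exact: continuous_funZ.
  move=> x; have -> : conv u (fun x => -1 * f' x + f x) =
      fun x => -1 * conv u f' x + conv u f x.
    by apply/funext => y; rewrite (conv_lin cK cu).
  rewrite (conv_lin cK cu); try exact: continuous_conv.
  by rewrite Ef Ef'; ring.
- move=> h f [cf Ef]; split; first exact: continuous_translate.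
  move=> x; have -> : conv u (fun y => f (h * y)%g) =
      fun y => conv u f (h * y)%g.
    by apply/funext => y; exact: conv_translate.
  by rewrite conv_translate //; exact: continuous_conv.
- by move=> g' h f x _; rewrite mulgA.
- by move=> f [cf _]; exact: continuous_bounded.
- move=> e e0; have [c uc] := continuous_bounded cK cu.
  have c0 : 0 <= c by exact: le_trans (uc 1%g).
  have c1 : 0 < c + 1 by rewrite ltr_wpDl.
  (* On [E] one has [l * f = conv u (conv u f)] with [conv u f] bounded by [c * b], so modulus [d]
     for the operator yields [d * c * b / l <= e * b]. *)
  pose d := e * l / (c + 1).
  have d0 : 0 < d by rewrite !mulr_gt0 // invr_gt0.
  have := near_conv_translate cK cu d0.
  apply: filterS => v [_ Hv] f b [cf Ef] fb x.
  have b0 : 0 <= b by exact: le_trans (fb 1%g).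
  have := Hv (conv u f) (c * b) (continuous_conv cK cu cf)
    (conv_bound_sup cK cu uc cf fb) x.
  rewrite !Ef -mulrBr normrM gtr0_norm // => h.
  rewrite -(ler_pM2l l0); apply: (le_trans h).
  have -> : l * (e * b) = d * ((c + 1) * b).
    by rewrite [RHS]mulrA divfK ?gt_eqF //; ring.
  by rewrite ler_wpM2l ?(ltW d0) // mulrDl mul1r lerDl.
Qed.

(* The smallness bound improves itself by the factor 3/4, because
   2 (h - 1) = (h^2 - 1) - (h - 1)^2 as operators. *)
Lemma no_small_subgroups (R : realType) (G : topGroupType) (X : Type)
    (act : G -> X -> X) (E : set (X -> R)) (H : set G) :
  equicontinuous_action act E -> is_subgroup H ->
  (forall h f b, H h -> E f -> (forall x, `|f x| <= b) ->
    forall x, `|f (act h x) - f x| <= 2^-1 * b) ->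
  forall h f x, H h -> E f -> f (act h x) = f x.
Proof.
move=> aE [_ HM _] small.
have improve n : forall h f b, H h -> E f -> (forall x, `|f x| <= b) ->
    forall x, `|f (act h x) - f x| <= (3 / 4) ^+ n * b.
  elim: n => [|n IH] h f b Hh Ef fb x.
    rewrite mul1r; apply: le_trans (small h f b Hh Ef fb x) _.
    have : 0 <= b by exact: le_trans (fb x).
    lra.
  have Ed : E (fun y => f (act h y) - f y).
    by apply: (equiact_sub aE) => //; exact: (equiact_act aE).
  have h1 := IH h f b Hh Ef fb.
  have h2 := small h _ _ Hh Ed h1 x.
  (* With [q] the current bound, the square of [h] contributes [q] and the iterated difference
     [q / 2], so twice the difference is at most [3 / 2 * q]. *)
  have := IH (h * h)%g f b (HM _ _ Hh Hh) Ef fb x.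
  rewrite (equiact_mul aE) // exprS; move: h2.
  set q := (3 / 4) ^+ n * b; have -> : 3 / 4 * (3 / 4) ^+ n * b = 3 / 4 * q.
    by rewrite /q mulrA.
  by rewrite !ler_norml /=; lra.
move=> h f x Hh Ef; have [b fb] := equiact_bounded aE Ef.
have b0 : 0 <= b by exact: le_trans (fb x).
apply/eqP; rewrite -subr_eq0 -normr_le0.
apply/ler_addgt0Pr => e e0; rewrite add0r.
have b1 : 0 < b + 1 by rewrite ltr_wpDl.
have q0 : 0 <= 3 / 4 :> R by lra.
have q1 : `|3 / 4 : R| < 1 by rewrite ger0_norm //; lra.
have /cvgrPdist_lt/(_ (e / (b + 1)) (divr_gt0 e0 b1)) := cvg_expr q1.
case=> n _ /(_ n (leqnn n)); rewrite /= sub0r normrN.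
rewrite ger0_norm ?exprn_ge0 // => qn.
apply: le_trans (improve n h f b Hh Ef fb x) _.
move: qn; rewrite ltr_pdivlMr // mulrDr mulr1.
have : 0 <= (3 / 4 : R) ^+ n by rewrite exprn_ge0.
by set q := _ ^+ n; move=> *; lra.
Qed.

(** The trivial subgroup lies in every neighborhood of [1], so [no_small_subgroups] applies to
    it. *)
Lemma equicontinuous_action1 (R : realType) (G : topGroupType) (X : Type)
    (act : G -> X -> X) (E : set (X -> R)) :
  equicontinuous_action act E -> forall f x, E f -> f (act 1%g x) = f x.
Proof.
move=> aE f x; apply: (@no_small_subgroups R G X act E [set 1%g] aE) => //.
  by split=> [//|_ _ -> ->|_ ->] /=; rewrite ?mulg1 ?invg1.
move=> _ f' b -> Ef' fb y.
have half : 0 < 2^-1 :> R by rewrite invr_gt0.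
by have /nbhs_singleton/(_ f' b Ef' fb y) := equiact_near aE half.
Qed.

(** * The kernel of an action and the passage to quotients *)

Section Kernel.
Context {R : realType} {G : topGroupType} {X : Type}.
Variables (act : G -> X -> X) (E : set (X -> R)).
Hypothesis aE : equicontinuous_action act E.

Definition action_ker : set G := [set g | forall f x, E f -> f (act g x) = f x].

Lemma action_ker_subgroup : is_subgroup action_ker.
Proof.
split=> [f x|g h kg kh f x Ef|g kg f x Ef].
- exact: (equicontinuous_action1 aE).
- by rewrite (equiact_mul aE) // (kh _ _ (equiact_act aE g Ef)) kg.
- rewrite -(kg _ _ (equiact_act aE g^-1%g Ef)) -(equiact_mul aE) // mulVg.
  exact: (equicontinuous_action1 aE).
Qed.

Lemma action_ker_closed : closed action_ker.
Proof.
move=> g clg f x Ef; have [b fb] := equiact_bounded aE Ef.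
have b0 : 0 <= b by exact: le_trans (fb x).
apply/eqP; rewrite eq_sym -subr_eq0 -normr_le0.
apply/ler_addgt0Pr => e e0; rewrite add0r.
have b1 : 0 < b + 1 by rewrite ltr_wpDl.
have nU := equiact_near aE (divr_gt0 e0 b1).
(* Choose [k] in the kernel with [g^-1 * k] near [1] and apply the modulus to the translate of [f]
   by [g], which has the same bound [b]. *)
have [k [kk /= Uk]] : action_ker `&` (fun k => g^-1 * k)%g @^-1` [set v |
    forall f b', E f -> (forall x, `|f x| <= b') ->
    forall x, `|f (act v x) - f x| <= e / (b + 1) * b'] !=set0.
  apply: clg; apply: (continuous_mulg (a := fun=> g^-1%g) (b := id)) => /=.
  - by move=> ?; exact: cvg_cst.
  - by move=> ?; exact: cvg_id.
  - by rewrite mulVg.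
have := Uk _ b (equiact_act aE g Ef) (fun y => fb _) x.
rewrite -(equiact_mul aE) // mulVKg kk // => /le_trans; apply.
by rewrite -mulrA ger_pMr // mulrC ler_pdivrMr // mul1r lerDl.
Qed.

(** The representative of the coset of [g] is [g] times an element of [N], which acts trivially;
    openness of the projection carries over continuity at [1]. *)
Lemma quotient_action (N : closedNormalSubgroup G) :
  cns_set N `<=` action_ker ->
  equicontinuous_action (fun q : quotient_group N => act (qrepr q)) E.
Proof.
move=> Nker.
have actq g f x : E f -> f (act (qrepr (qpi N g)) x) = f (act g x).
  move=> Ef; have := Nker _ (qrepr_pi N g) _ x (equiact_act aE g Ef).
  by rewrite -(equiact_mul aE) // mulVKg.
split.
- by move=> f f'; exact: (equiact_sub aE).
- by move=> q f; exact: (equiact_act aE).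
- move=> p q f x Ef; rewrite -(equiact_mul aE) //.
  by rewrite -[in LHS](qreprK p) -[in LHS](qreprK q) -qpiM actq.
- by move=> f; exact: (equiact_bounded aE).
- move=> e e0; have := @qpi_nbhs G N _ _ (equiact_near aE e0).
  apply: filterS => _ [g Hg <-] f b Ef fb x.
  by rewrite actq //; exact: Hg.
Qed.

End Kernel.

(** * Induction over the classes SSGP(n) and the conclusion *)

Lemma SSGP_action_trivial (R : realType) (X : Type) n (G : topGroupType)
    (act : G -> X -> X) (E : set (X -> R)) :
  SSGP n G -> equicontinuous_action act E ->
  forall g f x, E f -> f (act g x) = f x.
Proof.
elim: n G act => [|n IH] G act /= GS aE g f x Ef.
  have -> : g = 1%g by have : [set: G] g by []; rewrite GS.
  exact: (equicontinuous_action1 aE).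
have half : 0 < 2^-1 :> R by rewrite invr_gt0.
(* The neighborhood is the one on which the action is within [2^-1] of the identity, as
   [no_small_subgroups] requires. *)
have [HH [HHs [N [NE SN]]]] := GS _ (equiact_near aE half).
have HHker : \bigcup_(K in HH) K `<=` action_ker act E.
  move=> h [K HK Kh] f' y Ef'; have [sK KU] := HHs _ HK.
  by apply: (no_small_subgroups aE sK) => // k f'' b /KU; exact.
have Nker : cns_set N `<=` action_ker act E.
  rewrite NE ((closure_id _).1 (action_ker_closed aE)).
  apply: closure_subset; apply: smallest_sub => //.
  exact: action_ker_subgroup.
have qE := quotient_action aE Nker.
have := Nker _ (qrepr_pi N g) _ x (equiact_act aE g Ef).
rewrite -(equiact_mul aE) // mulVKg => <-.
exact: (IH _ _ SN qE).
Qed.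

Theorem theorem2p5 (n : nat) (G : topGroupType) :
  SSGP n G -> minimally_almost_periodic G.
Proof.
move=> GS K phi cK cphi.
suff phi1 g : phi g = 1%g.
  apply/seteqP; split=> [_ [g _ <-]|_ ->]; first by rewrite phi1.
  by exists 1%g => //; exact: phi1.
apply/eqP; apply: contrapT => /negP phig.
have [E EK [f Ef [x]]] :=
  @compact_group_separation Rdefinitions.R K (phi g) cK phig.
apply/negP; rewrite negbK; apply/eqP.
(* [G] acts on [K] by left translation through [phi], and [E] is an equicontinuous space for this
   action too. *)
apply: (SSGP_action_trivial (act := fun g x => (phi g * x)%g) GS _ g x Ef).
split.
- exact: (equiact_sub EK).
- by move=> h; exact: (equiact_act EK (phi h)).
- by move=> h k f' y Ef'; rewrite gmulfM (equiact_mul EK).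
- exact: (equiact_bounded EK).
- move=> e e0; have nE := equiact_near EK e0.
  have phi1 : phi 1%g = 1%g.
    by apply: (mulgI (phi 1%g)); rewrite -gmulfM !mulg1.
  by rewrite -phi1 in nE; exact: (cphi _ _ nE).
Qed.
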